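(* Let $(\mathcal{C},\otimes,1)$ and $(\mathcal{D},\otimes,1')$ be monoidal categories, both having coequalizers and with every object coflat, and let $\varphi:R\to S$ be an algebra morphism in $\mathcal{C}$ such that $\varphi^*=-\otimes_R S:\mathcal{C}_R\to\mathcal{C}_S$ is semiseparable (resp., separable, naturally full). Let $(F:\mathcal{C}\to\mathcal{D},\phi^2,\phi^0)$ be a full, essentially surjective, strong monoidal functor, and assume that it preserves coequalizers. Then $F(\varphi)^*=-\otimes_{F(R)}F(S):\mathcal{D}_{F(R)}\to\mathcal{D}_{F(S)}$ is also semiseparable (resp., separable, naturally full).
   Context: Associativity and unit constraints are suppressed. For an algebra $A$ in a monoidal category $\mathcal{C}$, $m_A$ and $u_A$ are its multiplication and unit, and $\mathcal{C}_A$ (resp. ${}_A\mathcal{C}$) is the category of right (resp. left) $A$-modules in $\mathcal{C}$. An object $X$ is coflat if both $X\otimes-$ and $-\otimes X$ preserve coequalizers. For $M\in\mathcal{C}_A$ with action $\nu$ and $X\in{}_A\mathcal{C}$ with action $\mu$, $q^A_{M,X}:M\otimes X\to M\otimes_A X$ is the coequalizer of $\nu\otimes\mathrm{Id}_X$ and $\mathrm{Id}_M\otimes\mu$. For an algebra morphism $\varphi:R\to S$, $S$ is a left $R$-module via $m_S(\varphi\otimes\mathrm{Id}_S)$, and the induction functor $\varphi^*=-\otimes_R S:\mathcal{C}_R\to\mathcal{C}_S$ sends $X$ to $X\otimes_R S$ with right $S$-action induced by $m_S$, and $f:X\to Y$ to the unique morphism $f\otimes_R S$ with $(f\otimes_R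 S)q^R_{X,S}=q^R_{Y,S}(f\otimes\mathrm{Id}_S)$. A strong monoidal functor $(F,\phi^2,\phi^0)$ is a lax monoidal functor, with structure maps $\phi^2_{X,Y}:F(X)\otimes F(Y)\to F(X\otimes Y)$ (natural) and $\phi^0:1'\to F(1)$ satisfying the usual associativity and unit axioms, such that $\phi^2$ and $\phi^0$ are invertible. It sends an algebra $(R,m_R,u_R)$ to the algebra $(F(R),F(m_R)\phi^2_{R,R},F(u_R)\phi^0)$ and algebra morphisms to algebra morphisms. A functor $F:\mathcal{A}\to\mathcal{B}$ induces the natural transformation $\mathcal{F}:\mathrm{Hom}_{\mathcal{A}}(-,-)\to\mathrm{Hom}_{\mathcal{B}}(F-,F-)$, $f\mapsto F(f)$. $F$ is separable (resp. naturally full, semiseparable) if there is a natural transformation $\mathcal{P}:\mathrm{Hom}_{\mathcal{B}}(F-,F-)\to\mathrm{Hom}_{\mathcal{A}}(-,-)$ with $\mathcal{P}\circ\mathcal{F}=\mathrm{Id}$ (resp. $\mathcal{F}\circ\mathcal{P}=\mathrm{Id}$, $\mathcal{F}\circ\mathcal{P}\circ\mathcal{F}=\mathcal{F}$). *)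

(* Defs.v *)
From Stdlib Require Import ProofIrrelevance IndefiniteDescription.

Set Implicit Arguments.
Unset Strict Implicit.
Unset Printing Implicit Defensive.

Declare Scope cat_scope.
Local Open Scope cat_scope.

Reserved Notation "g ∘ f" (at level 40, left associativity).
Reserved Notation "X ⊗ Y" (at level 34, left associativity).
Reserved Notation "f ⊠ g" (at level 34, left associativity).

Record Category := {
  Ob :> Type;
  Hom : Ob -> Ob -> Type;
  idm : forall X, Hom X X;
  comp : forall X Y Z, Hom Y Z -> Hom X Y -> Hom X Z;
  compA : forall X Y Z W (h : Hom Z W) (g : Hom Y Z) (f : Hom X Y),
    comp h (comp g f) = comp (comp h g) f;
  comp1m : forall X Y (f : Hom X Y), comp (idm Y) f = f;
  compm1 : forall X Y (f : Hom X Y), comp f (idm X) = f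
}.
Arguments Hom {c} _ _.
Arguments idm {c} X.
Arguments comp {c X Y Z} _ _.
Notation "g ∘ f" := (comp g f) : cat_scope.

Definition is_iso (C : Category) (X Y : C) (f : Hom X Y) : Prop :=
  exists g : Hom Y X, g ∘ f = idm X /\ f ∘ g = idm Y.

Record Functor (C D : Category) := {
  fob :> C -> D;
  fmap : forall X Y : C, Hom X Y -> Hom (fob X) (fob Y);
  fmap1 : forall X : C, fmap (idm X) = idm (fob X);
  fmapM : forall (X Y Z : C) (g : Hom Y Z) (f : Hom X Y),
    fmap (g ∘ f) = fmap g ∘ fmap f
}.
Arguments fmap {C D} F {X Y} _ : rename.

Definition full (C D : Category) (F : Functor C D) : Prop :=
  forall (X Y : C) (g : Hom (F X) (F Y)), exists f : Hom X Y, fmap F f = g.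

Definition essentially_surjective (C D : Category) (F : Functor C D) : Prop :=
  forall Y : D, exists (X : C) (f : Hom (F X) Y), is_iso f.

Definition natural_on_homs (A B : Category) (F : Functor A B)
    (P : forall X Y : A, Hom (F X) (F Y) -> Hom X Y) : Prop :=
  forall (X X' Y Y' : A) (h : Hom X' X) (k : Hom Y Y') (g : Hom (F X) (F Y)),
    P X' Y' (fmap F k ∘ g ∘ fmap F h) = k ∘ P X Y g ∘ h.

Definition separable (A B : Category) (F : Functor A B) : Prop :=
  exists P : forall X Y : A, Hom (F X) (F Y) -> Hom X Y,
    natural_on_homs P /\
    forall (X Y : A) (f : Hom X Y), P X Y (fmap F f) = f.

Definition naturally_full (A B : Category) (F : Functor A B) : Prop :=
  exists P : forall X Y : A, Hom (F X) (F Y) -> Hom X Y,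
    natural_on_homs P /\
    forall (X Y : A) (g : Hom (F X) (F Y)), fmap F (P X Y g) = g.

Definition semiseparable (A B : Category) (F : Functor A B) : Prop :=
  exists P : forall X Y : A, Hom (F X) (F Y) -> Hom X Y,
    natural_on_homs P /\
    forall (X Y : A) (f : Hom X Y), fmap F (P X Y (fmap F f)) = fmap F f.

Definition is_coequalizer (C : Category) (X Y Q : C) (f g : Hom X Y)
    (q : Hom Y Q) : Prop :=
  q ∘ f = q ∘ g /\
  forall (Z : C) (h : Hom Y Z), h ∘ f = h ∘ g -> exists! k : Hom Q Z, k ∘ q = h.

(* An arbitrary choice of coequalizers: the functor [- ⊗_R S] depends on it
   (up to isomorphism). *)
Record Coequalizers (C : Category) := {
  coeq : forall (X Y : C) (f g : Hom X Y), C;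
  coeq_map : forall (X Y : C) (f g : Hom X Y), Hom Y (coeq f g);
  coeqP : forall (X Y : C) (f g : Hom X Y), is_coequalizer f g (coeq_map f g)
}.

Definition preserves_coequalizers (C D : Category) (F : Functor C D) : Prop :=
  forall (X Y Q : C) (f g : Hom X Y) (q : Hom Y Q),
    is_coequalizer f g q -> is_coequalizer (fmap F f) (fmap F g) (fmap F q).

Section CoequalizerFactorization.
Context (C : Category) (X Y Q : C) (f g : Hom X Y) (q : Hom Y Q).
Context (Hq : is_coequalizer f g q).

Lemma coeq_desc_ex (Z : C) (h : Hom Y Z) :
  h ∘ f = h ∘ g -> exists k : Hom Q Z, k ∘ q = h.
Proof. intros e; destruct (proj2 Hq Z h e) as [k [Hk _]]; now exists k. Qed.

Definition coeq_desc (Z : C) (h : Hom Y Z) (e : h ∘ f = h ∘ g) : Hom Q Z :=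
  proj1_sig (constructive_indefinite_description _ (coeq_desc_ex e)).

Lemma coeq_descE (Z : C) (h : Hom Y Z) (e : h ∘ f = h ∘ g) :
  coeq_desc e ∘ q = h.
Proof. exact (proj2_sig (constructive_indefinite_description _ (coeq_desc_ex e))). Qed.

Lemma coeq_epi (Z : C) (k k' : Hom Q Z) : k ∘ q = k' ∘ q -> k = k'.
Proof.
intros e.
assert (E : (k' ∘ q) ∘ f = (k' ∘ q) ∘ g)
  by now rewrite <- !compA, (proj1 Hq).
destruct (proj2 Hq Z _ E) as [l [_ Hl]].
now rewrite <- (Hl k e), <- (Hl k' eq_refl).
Qed.
End CoequalizerFactorization.

Record MonoidalCategory := {
  mcat :> Category;
  tens : mcat -> mcat -> mcat;
  tensm : forall X X' Y Y' : mcat,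
    Hom X X' -> Hom Y Y' -> Hom (tens X Y) (tens X' Y');
  tensm1 : forall X Y : mcat, tensm (idm X) (idm Y) = idm (tens X Y);
  tensmM : forall (X X' X'' Y Y' Y'' : mcat) (f' : Hom X' X'') (f : Hom X X')
      (g' : Hom Y' Y'') (g : Hom Y Y'),
    tensm (f' ∘ f) (g' ∘ g) = tensm f' g' ∘ tensm f g;
  one : mcat;
  assoc : forall X Y Z : mcat, Hom (tens (tens X Y) Z) (tens X (tens Y Z));
  lunit : forall X : mcat, Hom (tens one X) X;
  runit : forall X : mcat, Hom (tens X one) X;
  assoc_iso : forall X Y Z : mcat, is_iso (assoc X Y Z);
  lunit_iso : forall X : mcat, is_iso (lunit X);
  runit_iso : forall X : mcat, is_iso (runit X);
  assoc_nat : forall (X X' Y Y' Z Z' : mcat)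
      (f : Hom X X') (g : Hom Y Y') (h : Hom Z Z'),
    assoc X' Y' Z' ∘ tensm (tensm f g) h = tensm f (tensm g h) ∘ assoc X Y Z;
  lunit_nat : forall (X Y : mcat) (f : Hom X Y),
    lunit Y ∘ tensm (idm one) f = f ∘ lunit X;
  runit_nat : forall (X Y : mcat) (f : Hom X Y),
    runit Y ∘ tensm f (idm one) = f ∘ runit X;
  pentagon : forall X Y Z W : mcat,
    tensm (idm X) (assoc Y Z W) ∘ assoc X (tens Y Z) W
      ∘ tensm (assoc X Y Z) (idm W)
    = assoc X Y (tens Z W) ∘ assoc (tens X Y) Z W;
  triangle : forall X Y : mcat,
    tensm (idm X) (lunit Y) ∘ assoc X one Y = tensm (runit X) (idm Y)
}.
Arguments tens {m} _ _.
Arguments tensm {m X X' Y Y'} _ _.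
Arguments one {m}.
Arguments assoc {m} X Y Z.
Arguments lunit {m} X.
Arguments runit {m} X.
Notation "X ⊗ Y" := (tens X Y) : cat_scope.
Notation "f ⊠ g" := (tensm f g) : cat_scope.

Section TensorLemmas.
Context (C : MonoidalCategory).

Lemma tensm_l (X X' X'' Y : C) (g : Hom X' X'') (f : Hom X X') :
  (g ∘ f) ⊠ idm Y = (g ⊠ idm Y) ∘ (f ⊠ idm Y).
Proof. now rewrite <- tensmM, comp1m. Qed.

Lemma tensm_r (X Y Y' Y'' : C) (g : Hom Y' Y'') (f : Hom Y Y') :
  idm X ⊠ (g ∘ f) = (idm X ⊠ g) ∘ (idm X ⊠ f).
Proof. now rewrite <- tensmM, comp1m. Qed.

Lemma tensm_lr (X X' Y Y' : C) (f : Hom X X') (g : Hom Y Y') :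
  (f ⊠ idm Y') ∘ (idm X ⊠ g) = f ⊠ g.
Proof. now rewrite <- tensmM, comp1m, compm1. Qed.

Lemma tensm_rl (X X' Y Y' : C) (f : Hom X X') (g : Hom Y Y') :
  (idm X' ⊠ g) ∘ (f ⊠ idm Y) = f ⊠ g.
Proof. now rewrite <- tensmM, comp1m, compm1. Qed.

Lemma tensm_swap (X X' Y Y' : C) (f : Hom X X') (g : Hom Y Y') :
  (idm X' ⊠ g) ∘ (f ⊠ idm Y) = (f ⊠ idm Y') ∘ (idm X ⊠ g).
Proof. now rewrite tensm_rl, tensm_lr. Qed.

Lemma iso_mono (X Y Z : C) (a : Hom Y Z) (f g : Hom X Y) :
  is_iso a -> a ∘ f = a ∘ g -> f = g.
Proof.
intros [b [ba _]] e.
now rewrite <- (comp1m f), <- (comp1m g), <- ba, <- !compA, e.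
Qed.

Lemma iso_epi (X Y Z : C) (a : Hom X Y) (f g : Hom Y Z) :
  is_iso a -> f ∘ a = g ∘ a -> f = g.
Proof.
intros [b [_ ab]] e.
now rewrite <- (compm1 f), <- (compm1 g), <- ab, !compA, e.
Qed.

Lemma tens_one_faithful (X Y : C) (f g : Hom X Y) :
  f ⊠ idm one = g ⊠ idm one -> f = g.
Proof.
intros e; apply (iso_epi (runit_iso X)).
now rewrite <- !runit_nat, e.
Qed.

Lemma runit_tens (X Y : C) : (idm X ⊠ runit Y) ∘ assoc X Y one = runit (X ⊗ Y).
Proof.
apply tens_one_faithful, (iso_mono (assoc_iso X Y one)).
rewrite tensm_l, compA, assoc_nat, <- triangle, tensm_r.
rewrite <- (triangle (X ⊗ Y) one), compA, <- tensm1, assoc_nat.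
now rewrite <- !compA, <- pentagon, !compA.
Qed.

Definition tensL (X : C) : Functor C C.
Proof.
refine {| fob := fun Y => X ⊗ Y; fmap := fun Y Y' f => idm X ⊠ f |}.
- intros Y; apply tensm1.
- intros Y Y' Y'' g f; apply tensm_r.
Defined.

Definition tensR (X : C) : Functor C C.
Proof.
refine {| fob := fun Y => Y ⊗ X; fmap := fun Y Y' f => f ⊠ idm X |}.
- intros Y; apply tensm1.
- intros Y Y' Y'' g f; apply tensm_l.
Defined.

Definition coflat (X : C) : Prop :=
  preserves_coequalizers (tensL X) /\ preserves_coequalizers (tensR X).

End TensorLemmas.

Record Algebra (C : MonoidalCategory) := {
  alg :> C;
  amul : Hom (alg ⊗ alg) alg;
  aunit : Hom one alg;
  amulA : amul ∘ (amul ⊠ idm alg) = amul ∘ (idm alg ⊠ amul) ∘ assoc alg alg alg;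
  amul1l : amul ∘ (aunit ⊠ idm alg) = lunit alg;
  amul1r : amul ∘ (idm alg ⊠ aunit) = runit alg
}.
Arguments amul {C} _.
Arguments aunit {C} _.

Record AlgebraHom (C : MonoidalCategory) (R S : Algebra C) := {
  ahom :> Hom R S;
  ahomM : ahom ∘ amul R = amul S ∘ (ahom ⊠ ahom);
  ahom1 : ahom ∘ aunit R = aunit S
}.

Record RModule (C : MonoidalCategory) (A : Algebra C) := {
  rmod :> C;
  ract : Hom (rmod ⊗ A) rmod;
  ractA : ract ∘ (ract ⊠ idm A) = ract ∘ (idm rmod ⊠ amul A) ∘ assoc rmod A A;
  ract1 : ract ∘ (idm rmod ⊠ aunit A) = runit rmod
}.
Arguments ract {C A} _.

Record LModule (C : MonoidalCategory) (A : Algebra C) := {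
  lmod :> C;
  lact : Hom (A ⊗ lmod) lmod;
  lactA : lact ∘ (amul A ⊠ idm lmod) = lact ∘ (idm A ⊠ lact) ∘ assoc A A lmod;
  lact1 : lact ∘ (aunit A ⊠ idm lmod) = lunit lmod
}.
Arguments lact {C A} _.

Record RModuleHom (C : MonoidalCategory) (A : Algebra C) (M N : RModule A) := {
  rhom :> Hom M N;
  rhomP : rhom ∘ ract M = ract N ∘ (rhom ⊠ idm A)
}.

Lemma RModuleHom_eq (C : MonoidalCategory) (A : Algebra C) (M N : RModule A)
  (f g : RModuleHom M N) : rhom f = rhom g -> f = g.
Proof.
destruct f as [f Hf], g as [g Hg]; simpl; intros e; subst g.
now rewrite (proof_irrelevance _ Hf Hg).
Qed.

Section ModuleCategory.
Context (C : MonoidalCategory) (A : Algebra C).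

Definition rhom_id (M : RModule A) : RModuleHom M M.
Proof. exists (idm M); now rewrite tensm1, comp1m, compm1. Defined.

Definition rhom_comp (M N P : RModule A) (g : RModuleHom N P)
  (f : RModuleHom M N) : RModuleHom M P.
Proof.
exists (rhom g ∘ rhom f).
now rewrite tensm_l, <- compA, rhomP, !compA, rhomP.
Defined.

Definition RMod : Category.
Proof.
refine {| Ob := RModule A; Hom := @RModuleHom C A;
          idm := rhom_id; comp := rhom_comp |}.
- intros; apply RModuleHom_eq; apply compA.
- intros; apply RModuleHom_eq; apply comp1m.
- intros; apply RModuleHom_eq; apply compm1.
Defined.
End ModuleCategory.

Section RelativeTensor.
Context (C : MonoidalCategory) (K : Coequalizers C) (A : Algebra C).
Context (M : RModule A) (X : LModule A).

Definition balance_l : Hom ((M ⊗ A) ⊗ X) (M ⊗ X) := ract M ⊠ idm X.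
Definition balance_r : Hom ((M ⊗ A) ⊗ X) (M ⊗ X) :=
  (idm M ⊠ lact X) ∘ assoc M A X.

Definition rtens : C := coeq K balance_l balance_r.
Definition rtensq : Hom (M ⊗ X) rtens := coeq_map K balance_l balance_r.

Lemma rtensqP : is_coequalizer balance_l balance_r rtensq.
Proof. apply coeqP. Qed.

Lemma rtensqE :
  rtensq ∘ (ract M ⊠ idm X) = rtensq ∘ ((idm M ⊠ lact X) ∘ assoc M A X).
Proof. exact (proj1 rtensqP). Qed.
End RelativeTensor.

Definition restrict_left (C : MonoidalCategory) (R S : Algebra C)
  (phi : AlgebraHom R S) : LModule R.
Proof.
refine {| lmod := S; lact := amul S ∘ (phi ⊠ idm S) |}.
- rewrite <- compA, <- tensm_l, ahomM, tensm_l, compA, amulA.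
  rewrite tensm_r, <- !compA; f_equal.
  rewrite assoc_nat, !compA, <- !tensmM, compm1, !comp1m; f_equal.
  now rewrite compm1.
- now rewrite <- compA, <- tensm_l, ahom1, amul1l.
Defined.

Lemma restrict_leftM (C : MonoidalCategory) (R S : Algebra C)
    (phi : AlgebraHom R S) (mu := amul S ∘ (phi ⊠ idm S)) :
  amul S ∘ (mu ⊠ idm S) = mu ∘ (idm R ⊠ amul S) ∘ assoc R S S.
Proof.
unfold mu.
rewrite tensm_l, compA, amulA, <- (compA (amul S ∘ _)), assoc_nat, tensm1.
rewrite !compA; f_equal.
now rewrite <- !compA, tensm_swap.
Qed.

Section Induction.
Context (C : MonoidalCategory) (K : Coequalizers C).
Context (all_coflat : forall X : C, coflat X).
Context (R S : Algebra C) (phi : AlgebraHom R S).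

Local Notation S' := (restrict_left phi).
Local Notation q X := (rtensq K X S').

Lemma rtensq_S (X : RModule R) :
  is_coequalizer (balance_l X S' ⊠ idm S) (balance_r X S' ⊠ idm S)
    (q X ⊠ idm S).
Proof. exact (proj2 (all_coflat S) _ _ _ _ _ _ (rtensqP K X _)). Qed.

Lemma rtensq_tens (X : RModule R) (Y Z : C)
    (k k' : Hom (rtens K X S' ⊗ Y) Z) :
  k ∘ (q X ⊠ idm Y) = k' ∘ (q X ⊠ idm Y) -> k = k'.
Proof.
apply coeq_epi with (1 := proj2 (all_coflat Y) _ _ _ _ _ _ (rtensqP K X _)).
Qed.

Lemma rtensq_tens2 (X : RModule R) (Y Y' Z : C)
    (k k' : Hom ((rtens K X S' ⊗ Y) ⊗ Y') Z) :
  k ∘ ((q X ⊠ idm Y) ⊠ idm Y') = k' ∘ ((q X ⊠ idm Y) ⊠ idm Y') -> k = k'.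
Proof.
apply coeq_epi with (1 := proj2 (all_coflat Y') _ _ _ _ _ _
  (proj2 (all_coflat Y) _ _ _ _ _ _ (rtensqP K X _))).
Qed.

Lemma rtensq_restrict (X : RModule R) (mu := amul S ∘ (phi ⊠ idm S)) :
  q X ∘ (ract X ⊠ idm S) = q X ∘ ((idm X ⊠ mu) ∘ assoc X R S).
Proof. exact (rtensqE K X S'). Qed.

Lemma induct_act_subproof (X : RModule R) :
  (q X ∘ ((idm X ⊠ amul S) ∘ assoc X S S)) ∘ (balance_l X S' ⊠ idm S)
  = (q X ∘ ((idm X ⊠ amul S) ∘ assoc X S S)) ∘ (balance_r X S' ⊠ idm S).
Proof.
unfold balance_l, balance_r; simpl.
rewrite <- !compA, assoc_nat, tensm1, (compA (idm X ⊠ amul S)), tensm_swap.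
rewrite tensm_l, (compA (assoc X S S)), assoc_nat.
rewrite !(compA (idm X ⊠ amul S)), <- tensm_r,
  restrict_leftM, !tensm_r.
rewrite <- !compA, (compA _ (assoc _ _ _)), pentagon.
rewrite !(compA (q X)), (rtensq_restrict X).
rewrite tensm_r, <- !compA; do 3 f_equal.
now rewrite !compA, <- tensm1, assoc_nat.
Qed.

(* The action on [X ⊗_R S] is the unique one satisfying [induct_actE]. *)
Definition induct_act (X : RModule R) : Hom (rtens K X S' ⊗ S) (rtens K X S') :=
  coeq_desc (rtensq_S X) (induct_act_subproof X).

Lemma induct_actE (X : RModule R) :
  induct_act X ∘ (q X ⊠ idm S) = q X ∘ ((idm X ⊠ amul S) ∘ assoc X S S).
Proof. apply coeq_descE. Qed.

Lemma induct_actA (X : RModule R) :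
  induct_act X ∘ (induct_act X ⊠ idm S)
  = induct_act X ∘ (idm _ ⊠ amul S) ∘ assoc _ S S.
Proof.
apply rtensq_tens2.
rewrite <- (compA _ (induct_act X ⊠ idm S)), <- tensm_l, induct_actE.
rewrite tensm_l, compA, induct_actE, tensm_l, <- !compA.
rewrite assoc_nat, tensm1, (compA (idm _ ⊠ amul S) (q X ⊠ _)), tensm_swap.
rewrite <- !compA, (compA _ (q X ⊠ idm S)), induct_actE, <- !compA; f_equal.
rewrite (compA (assoc X S S) ((_ ⊠ _) ⊠ _)), assoc_nat.
rewrite !(compA (idm X ⊠ amul S)), <- tensm_r, amulA, !tensm_r.
rewrite <- !compA, (compA _ (assoc _ _ _)), pentagon; f_equal.
now rewrite !compA, <- tensm1, assoc_nat.
Qed.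

Lemma induct_act1 (X : RModule R) :
  induct_act X ∘ (idm _ ⊠ aunit S) = runit (rtens K X S').
Proof.
apply rtensq_tens.
rewrite <- compA, tensm_swap, compA, induct_actE, runit_nat, <- !compA.
f_equal; simpl.
now rewrite <- tensm1, assoc_nat, compA, <- tensm_r, amul1r, runit_tens.
Qed.

Definition induct_ob (X : RModule R) : RModule S :=
  {| rmod := rtens K X S'; ract := induct_act X;
     ractA := induct_actA X; ract1 := induct_act1 X |}.

Lemma induct_hom_subproof (X Y : RModule R) (f : RModuleHom X Y) :
  (q Y ∘ (f ⊠ idm S)) ∘ balance_l X S' = (q Y ∘ (f ⊠ idm S)) ∘ balance_r X S'.
Proof.
unfold balance_l, balance_r; simpl.
rewrite <- !compA, <- tensm_l, rhomP, tensm_l, compA.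
pose proof (rtensq_restrict Y) as e; simpl in e; rewrite e; clear e.
rewrite <- !compA; f_equal.
rewrite assoc_nat, tensm1, compA, tensm_swap.
now rewrite compA.
Qed.

Definition induct_mor (X Y : RModule R) (f : RModuleHom X Y) :
    Hom (rtens K X S') (rtens K Y S') :=
  coeq_desc (rtensqP K X S') (induct_hom_subproof f).

Lemma induct_morE (X Y : RModule R) (f : RModuleHom X Y) :
  induct_mor f ∘ q X = q Y ∘ (f ⊠ idm S).
Proof. apply coeq_descE. Qed.

Lemma induct_mor_linear (X Y : RModule R) (f : RModuleHom X Y) :
  induct_mor f ∘ ract (induct_ob X)
  = ract (induct_ob Y) ∘ (induct_mor f ⊠ idm S).
Proof.
apply rtensq_tens; simpl.
rewrite <- !compA, <- tensm_l, induct_morE, induct_actE, tensm_l.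
rewrite !compA, induct_morE, induct_actE, <- !compA; f_equal.
rewrite assoc_nat, tensm1, !compA; f_equal.
now rewrite tensm_swap.
Qed.

Definition induct_hom (X Y : RModule R) (f : RModuleHom X Y) :
    RModuleHom (induct_ob X) (induct_ob Y) :=
  @Build_RModuleHom C S (induct_ob X) (induct_ob Y)
    (induct_mor f) (induct_mor_linear f).

Lemma induct_hom1 (X : RModule R) :
  induct_hom (idm (X : RMod R)) = idm (induct_ob X : RMod S).
Proof.
apply RModuleHom_eq; simpl.
apply (coeq_epi (rtensqP K X S')).
now rewrite induct_morE, comp1m; simpl; rewrite tensm1, compm1.
Qed.

Lemma induct_homM (X Y Z : RMod R) (g : Hom Y Z) (f : Hom X Y) :
  induct_hom (g ∘ f)
  = (induct_hom g : Hom (induct_ob Y : RMod S) (induct_ob Z)) ∘ induct_hom f.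
Proof.
apply RModuleHom_eq; simpl.
apply (coeq_epi (rtensqP K X S')).
rewrite induct_morE, <- compA, induct_morE, compA, induct_morE, <- compA.
now simpl; rewrite tensm_l.
Qed.

(* [φ^* = - ⊗_R S]. *)
Definition induction : Functor (RMod R) (RMod S) :=
  {| fob := induct_ob : RMod R -> RMod S; fmap := induct_hom;
     fmap1 := induct_hom1; fmapM := induct_homM |}.
End Induction.

Record StrongMonoidalFunctor (C D : MonoidalCategory) := {
  smf :> Functor C D;
  phi2 : forall X Y : C, Hom (smf X ⊗ smf Y) (smf (X ⊗ Y));
  phi0 : Hom one (smf one);
  phi2_nat : forall (X X' Y Y' : C) (f : Hom X X') (g : Hom Y Y'),
    phi2 X' Y' ∘ (fmap smf f ⊠ fmap smf g) = fmap smf (f ⊠ g) ∘ phi2 X Y;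
  phi2A : forall X Y Z : C,
    fmap smf (assoc X Y Z) ∘ phi2 (X ⊗ Y) Z ∘ (phi2 X Y ⊠ idm (smf Z))
    = phi2 X (Y ⊗ Z) ∘ (idm (smf X) ⊠ phi2 Y Z)
        ∘ assoc (smf X) (smf Y) (smf Z);
  phi2_1l : forall X : C,
    fmap smf (lunit X) ∘ phi2 one X ∘ (phi0 ⊠ idm (smf X)) = lunit (smf X);
  phi2_1r : forall X : C,
    fmap smf (runit X) ∘ phi2 X one ∘ (idm (smf X) ⊠ phi0) = runit (smf X);
  phi2_iso : forall X Y : C, is_iso (phi2 X Y);
  phi0_iso : is_iso phi0
}.
Arguments phi2 {C D} _ X Y.
Arguments phi0 {C D} _.

Section MapAlgebra.
Context (C D : MonoidalCategory) (F : StrongMonoidalFunctor C D).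

Definition map_algebra (R : Algebra C) : Algebra D.
Proof.
refine {| alg := F R; amul := fmap F (amul R) ∘ phi2 F R R;
          aunit := fmap F (aunit R) ∘ phi0 F |}.
- rewrite tensm_l, tensm_r, <- !compA, !(compA (phi2 F R R)).
  rewrite <- (fmap1 F R), !phi2_nat, <- !compA, !(compA (fmap F (amul R))).
  rewrite <- !fmapM, amulA, (fmapM F _ (assoc R R R)), <- !compA; f_equal.
  now rewrite !compA, fmap1, phi2A.
- rewrite tensm_l, <- !compA, (compA (phi2 F R R)).
  rewrite <- (fmap1 F R), phi2_nat, <- !compA, (compA (fmap F (amul R))).
  now rewrite <- fmapM, amul1l, fmap1, compA, phi2_1l.
- rewrite tensm_r, <- !compA, (compA (phi2 F R R)).
  rewrite <- (fmap1 F R), phi2_nat, <- !compA, (compA (fmap F (amul R))).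
  now rewrite <- fmapM, amul1r, fmap1, compA, phi2_1r.
Defined.

Definition map_algebra_hom (R S : Algebra C) (phi : AlgebraHom R S) :
  AlgebraHom (map_algebra R) (map_algebra S).
Proof.
exists (fmap F phi); simpl.
- now rewrite <- (compA _ (phi2 F S S)), phi2_nat, !compA, <- !fmapM, ahomM.
- now rewrite compA, <- fmapM, ahom1.
Defined.
End MapAlgebra.

(* Main.v *)
(** By Rafael's criterion for the adjunction between [φ^* = - ⊗_R S] and
    restriction of scalars, each of the three properties amounts to a natural
    R-linear family [γ_X : X ⊗_R S -> X] with, for the unit [η] of the adjunction,
    [γ η = 1], [η γ = 1] or [η γ η = η].  Only the images of such a family on
    modules [F (Y ⊗ R)] are natural for all [F R]-linear maps, because a linear map
    out of a free module is determined by its restriction [F Y -> F N], which lifts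
    along the full functor [F].  Every [F R]-module [M] is a quotient of such a
    module, since [M ≅ F X] in [D]; as the quotient map [F (X ⊗ R) -> M] splits in
    [D], naturality determines [γ_M], and the identities descend to [M]. *)
From Stdlib Require Import IndefiniteDescription.
Require Import Defs.
Local Open Scope cat_scope.

Set Implicit Arguments.
Unset Strict Implicit.
Unset Printing Implicit Defensive.

(** * Rafael-type criteria for the left adjoint of an adjunction *)

Section Rafael.
Context (A B : Category) (L : Functor A B) (U : Functor B A).
Context (eta : forall X : A, Hom X (U (L X))) (eps : forall Y : B, Hom (L (U Y)) Y).
Hypothesis eta_nat : forall (X Y : A) (f : Hom X Y),
  eta Y ∘ f = fmap U (fmap L f) ∘ eta X.
Hypothesis eps_nat : forall (X Y : B) (f : Hom X Y),
  eps Y ∘ fmap L (fmap U f) = f ∘ eps X.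
Hypothesis triangle_l : forall X : A, eps (L X) ∘ fmap L (eta X) = idm (L X).
Hypothesis triangle_r : forall Y : B, fmap U (eps Y) ∘ eta (U Y) = idm (U Y).

Definition natural_retract (gamma : forall X : A, Hom (U (L X)) X) : Prop :=
  forall (X Y : A) (f : Hom X Y), f ∘ gamma X = gamma Y ∘ fmap U (fmap L f).

Lemma transpose_inj (X : A) (Y : B) (f g : Hom (L X) Y) :
  fmap U f ∘ eta X = fmap U g ∘ eta X -> f = g.
Proof.
(* A map out of [L X] is recovered from its transpose by applying [L] and composing with the
   counit. *)
assert (T : forall h : Hom (L X) Y, eps Y ∘ fmap L (fmap U h ∘ eta X) = h).
{ intros h; rewrite fmapM, compA, eps_nat, <- compA, triangle_l; apply compm1. }
intros e; now rewrite <- (T f), e, T.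
Qed.

(** A natural [P] is determined by its values on counits: [g : L X -> L Y] equals
    [eps (L Y) ∘ fmap L (fmap U g ∘ eta X)], and naturality pulls the second factor out of [P].
    [homs_of] rebuilds [P] from these values by that formula. *)
Definition retract_of (P : forall X Y : A, Hom (L X) (L Y) -> Hom X Y) (X : A) :
  Hom (U (L X)) X := P (U (L X)) X (eps (L X)).

Definition homs_of (gamma : forall X : A, Hom (U (L X)) X) (X Y : A)
  (g : Hom (L X) (L Y)) : Hom X Y := gamma Y ∘ fmap U g ∘ eta X.

Section FromHoms.
Context (P : forall X Y : A, Hom (L X) (L Y) -> Hom X Y) (HP : natural_on_homs P).

Lemma natural_homs_post (X Y Y' : A) (k : Hom Y Y') (g : Hom (L X) (L Y)) :
  P (fmap L k ∘ g) = k ∘ P g.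
Proof.
generalize (HP (idm X) k g); now rewrite fmap1, !compm1.
Qed.

Lemma natural_homs_pre (X X' Y : A) (h : Hom X' X) (g : Hom (L X) (L Y)) :
  P (g ∘ fmap L h) = P g ∘ h.
Proof.
generalize (HP h (idm Y) g); now rewrite fmap1, !comp1m.
Qed.

Lemma retract_of_natural : natural_retract (retract_of P).
Proof.
intros X Y f; unfold retract_of.
now rewrite <- natural_homs_post, <- natural_homs_pre, eps_nat.
Qed.

Lemma retract_of_eta (X : A) : retract_of P X ∘ eta X = P (idm (L X)).
Proof.
unfold retract_of; now rewrite <- natural_homs_pre, triangle_l.
Qed.
End FromHoms.

Section FromRetract.
Context (gamma : forall X : A, Hom (U (L X)) X) (Hgamma : natural_retract gamma).

Lemma homs_of_natural : natural_on_homs (homs_of gamma).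
Proof.
intros X X' Y Y' h k g; unfold homs_of.
rewrite !fmapM, !compA, <- Hgamma, <- !compA; do 3 f_equal.
now rewrite eta_nat.
Qed.

Lemma homs_of_fmap (X Y : A) (f : Hom X Y) :
  homs_of gamma (fmap L f) = gamma Y ∘ eta Y ∘ f.
Proof. unfold homs_of; now rewrite <- !compA, eta_nat. Qed.
End FromRetract.

Lemma separable_iff_retract :
  separable L <-> exists gamma, natural_retract gamma /\
    forall X : A, gamma X ∘ eta X = idm X.
Proof.
split.
- intros [P [HP PK]]; exists (retract_of P); split.
  + now apply retract_of_natural.
  + intros X; now rewrite retract_of_eta, <- fmap1.
- intros [gamma [Hg gK]]; exists (homs_of gamma); split.
  + now apply homs_of_natural.
  + intros X Y f; now rewrite homs_of_fmap, gK, comp1m.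
Qed.

Lemma naturally_full_iff_retract :
  naturally_full L <-> exists gamma, natural_retract gamma /\
    forall X : A, eta X ∘ gamma X = idm (U (L X)).
Proof.
split.
- intros [P [HP PK]]; exists (retract_of P); split.
  + now apply retract_of_natural.
  + intros X; unfold retract_of; now rewrite eta_nat, PK, triangle_r.
- intros [gamma [Hg gK]]; exists (homs_of gamma); split.
  + now apply homs_of_natural.
  + intros X Y g; apply transpose_inj; rewrite <- eta_nat; unfold homs_of.
    now rewrite !compA, gK, comp1m.
Qed.

Lemma semiseparable_iff_retract :
  semiseparable L <-> exists gamma, natural_retract gamma /\
    forall X : A, eta X ∘ gamma X ∘ eta X = eta X.
Proof.
split.
- intros [P [HP PK]]; exists (retract_of P); split.
  + now apply retract_of_natural.
  + intros X; rewrite <- compA, retract_of_eta by assumption.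
    (* The identity of [L X] is written as [fmap L (idm X)], so that the hypothesis on [P] applies
       to it. *)
    rewrite eta_nat, <- fmap1, PK, !fmap1; apply comp1m.
- intros [gamma [Hg gK]]; exists (homs_of gamma); split.
  + now apply homs_of_natural.
  + intros X Y f; apply transpose_inj; rewrite <- !eta_nat, homs_of_fmap.
    now rewrite !compA, gK.
Qed.
End Rafael.

(** * Chosen inverses of isomorphisms *)

Section Inverse.
Context (C : Category) (X Y : C) (f : Hom X Y) (f_iso : is_iso f).

Definition iso_inv : Hom Y X :=
  proj1_sig (constructive_indefinite_description _ f_iso).

Lemma iso_invK : iso_inv ∘ f = idm X.
Proof. exact (proj1 (proj2_sig (constructive_indefinite_description _ f_iso))). Qed.

Lemma iso_Kinv : f ∘ iso_inv = idm Y.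
Proof. exact (proj2 (proj2_sig (constructive_indefinite_description _ f_iso))). Qed.
End Inverse.

(** * Free modules over an algebra *)

Section TensorUnit.
Context (C : MonoidalCategory) (A : Algebra C).

(** The unit of the free module adjunction, that is, the inclusion of generators of [X ⊗ A]. *)
Definition tens_unit (X : C) : Hom X (X ⊗ A) :=
  (idm X ⊠ aunit A) ∘ iso_inv (runit_iso X).

Lemma tens_unit_runit (X : C) : tens_unit X ∘ runit X = idm X ⊠ aunit A.
Proof. unfold tens_unit; now rewrite <- compA, iso_invK, compm1. Qed.

Lemma tens_unit_nat (X Y : C) (f : Hom X Y) :
  (f ⊠ idm A) ∘ tens_unit X = tens_unit Y ∘ f.
Proof.
apply (iso_epi (runit_iso X)).
rewrite <- !compA, tens_unit_runit, <- runit_nat, compA, tens_unit_runit.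
now rewrite tensm_swap.
Qed.

Lemma ract_tens_unit (M : RModule A) : ract M ∘ tens_unit M = idm M.
Proof.
apply (iso_epi (runit_iso M)).
now rewrite <- compA, tens_unit_runit, ract1, comp1m.
Qed.

Lemma amul_tens_unit : amul A ∘ tens_unit A = idm A.
Proof.
apply (iso_epi (runit_iso A)).
now rewrite <- compA, tens_unit_runit, amul1r, comp1m.
Qed.

Lemma assoc_tens_unit (X Y : C) :
  assoc X Y A ∘ tens_unit (X ⊗ Y) = idm X ⊠ tens_unit Y.
Proof.
apply (iso_epi (runit_iso (X ⊗ Y))).
rewrite <- compA, tens_unit_runit, <- tensm1, assoc_nat, <- runit_tens, compA.
now rewrite <- tensm_r, tens_unit_runit.
Qed.

Definition free_act (X : C) : Hom ((X ⊗ A) ⊗ A) (X ⊗ A) :=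
  (idm X ⊠ amul A) ∘ assoc X A A.

Lemma free_act_tens_unit (X : C) :
  free_act X ∘ (tens_unit X ⊠ idm A) = idm (X ⊗ A).
Proof.
apply (iso_epi (a := runit X ⊠ idm A)).
- exists (iso_inv (runit_iso X) ⊠ idm A).
  now rewrite <- !tensm_l, iso_invK, iso_Kinv, !tensm1.
- unfold free_act.
  rewrite <- compA, <- tensm_l, tens_unit_runit, <- compA, assoc_nat, compA.
  now rewrite <- tensm_r, amul1l, comp1m, triangle.
Qed.

(** Associativity of [amul A] tensored with [X]; the pentagon reconciles the bracketings. *)
Lemma free_actA (X : C) :
  free_act X ∘ (free_act X ⊠ idm A)
  = free_act X ∘ (idm (X ⊗ A) ⊠ amul A) ∘ assoc (X ⊗ A) A A.
Proof.
unfold free_act.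
rewrite tensm_l, <- !compA, (compA (assoc X A A) ((_ ⊠ _) ⊠ _)), assoc_nat.
rewrite !(compA (idm X ⊠ amul A)), <- tensm_r, amulA, !tensm_r.
rewrite <- !compA, (compA _ (assoc _ _ _)), pentagon; f_equal.
now rewrite !compA, <- tensm1, assoc_nat.
Qed.

Lemma free_act1 (X : C) :
  free_act X ∘ (idm (X ⊗ A) ⊠ aunit A) = runit (X ⊗ A).
Proof.
unfold free_act.
now rewrite <- compA, <- tensm1, assoc_nat, compA, <- tensm_r, amul1r, runit_tens.
Qed.

Definition free_module (X : C) : RModule A :=
  {| rmod := X ⊗ A; ract := free_act X;
     ractA := free_actA X; ract1 := free_act1 X |}.

Section FreeExtension.
Context (X : C) (M : RModule A).

Lemma free_ext_linear (h : Hom X M) :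
  ract M ∘ (h ⊠ idm A) ∘ free_act X = ract M ∘ ((ract M ∘ (h ⊠ idm A)) ⊠ idm A).
Proof.
unfold free_act.
rewrite tensm_l, (compA (ract M)), ractA, <- !compA, assoc_nat, tensm1.
now rewrite (compA (idm M ⊠ _)), tensm_swap, <- compA.
Qed.

Definition free_ext (h : Hom X M) : RModuleHom (free_module X) M :=
  Build_RModuleHom (M := free_module X) (free_ext_linear h).

Lemma free_extE (h : Hom X M) : free_ext h ∘ tens_unit X = h.
Proof.
simpl; rewrite <- compA, tens_unit_nat, compA, ract_tens_unit; apply comp1m.
Qed.
End FreeExtension.
End TensorUnit.

(** * Restriction of scalars along [phi] *)

Section Restriction.
Context (C : MonoidalCategory) (R S : Algebra C) (phi : AlgebraHom R S).

Lemma restrict_actA (N : RModule S) (nu := ract N ∘ (idm N ⊠ phi)) :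
  nu ∘ (nu ⊠ idm R) = nu ∘ (idm N ⊠ amul R) ∘ assoc N R R.
Proof.
unfold nu.
rewrite tensm_l, <- !compA, (compA (idm N ⊠ phi)), tensm_swap.
rewrite <- !compA, (compA (ract N)), ractA.
rewrite (compA (idm N ⊠ phi) (idm N ⊠ amul R)), <- tensm_r, ahomM, tensm_r.
rewrite <- !compA; do 2 f_equal.
now rewrite <- assoc_nat, tensm_rl.
Qed.

Lemma restrict_act1 (N : RModule S) :
  ract N ∘ (idm N ⊠ phi) ∘ (idm N ⊠ aunit R) = runit N.
Proof. now rewrite <- compA, <- tensm_r, ahom1, ract1. Qed.

Definition restrict_ob (N : RModule S) : RModule R :=
  {| rmod := N; ract := ract N ∘ (idm N ⊠ phi);
     ractA := restrict_actA N; ract1 := restrict_act1 N |}.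

Lemma restrict_hom_linear (M N : RModule S) (f : RModuleHom M N) :
  f ∘ (ract M ∘ (idm M ⊠ phi)) = ract N ∘ (idm N ⊠ phi) ∘ (f ⊠ idm R).
Proof. now rewrite compA, rhomP, <- !compA, tensm_swap. Qed.

Definition restrict_hom (M N : RModule S) (f : RModuleHom M N) :
    RModuleHom (restrict_ob M) (restrict_ob N) :=
  Build_RModuleHom (M := restrict_ob M) (N := restrict_ob N)
    (restrict_hom_linear f).

Definition restriction : Functor (RMod S) (RMod R).
Proof.
refine {| fob := restrict_ob : RMod S -> RMod R; fmap := restrict_hom |};
  intros; now apply RModuleHom_eq.
Defined.
End Restriction.

(** * The adjunction between induction and restriction, and retractions of its unit *)

Section InductionRestriction.
Context (C : MonoidalCategory) (K : Coequalizers C).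
Context (all_coflat : forall X : C, coflat X).
Context (R S : Algebra C) (phi : AlgebraHom R S).

Local Notation Ind := (induct_ob K all_coflat phi).
Local Notation Res := (restrict_ob phi).
Local Notation T X := (rtens K X (restrict_left phi)).
Local Notation act X := (induct_act K all_coflat phi X).
Local Notation mu := (amul S ∘ (phi ⊠ idm S)).

(* [rtensq] with the module [S] spelled [S] instead of [restrict_left phi] in
   its type: this keeps composites syntactically well-matched for rewriting. *)
Definition induct_proj (X : RModule R) : Hom (X ⊗ S) (T X) :=
  rtensq K X (restrict_left phi).
Local Notation q X := (induct_proj X).

Lemma induct_projP (X : RModule R) :
  is_coequalizer (ract X ⊠ idm S) ((idm X ⊠ mu) ∘ assoc X R S) (q X).
Proof. exact (rtensqP K X (restrict_left phi)). Qed.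

Lemma induct_proj_balanced (X : RModule R) :
  q X ∘ (ract X ⊠ idm S) = q X ∘ ((idm X ⊠ mu) ∘ assoc X R S).
Proof. exact (proj1 (induct_projP X)). Qed.

Lemma induct_proj_tens (X : RModule R) (Y Z : C) (k k' : Hom (T X ⊗ Y) Z) :
  k ∘ (q X ⊠ idm Y) = k' ∘ (q X ⊠ idm Y) -> k = k'.
Proof. exact (rtensq_tens all_coflat (k' := k')). Qed.

Lemma induct_proj_act (X : RModule R) :
  act X ∘ (q X ⊠ idm S) = q X ∘ free_act S X.
Proof. exact (induct_actE K all_coflat phi X). Qed.

Lemma induct_proj_mor (X Y : RModule R) (f : RModuleHom X Y) :
  induct_mor K phi f ∘ q X = q Y ∘ (f ⊠ idm S).
Proof. exact (induct_morE K phi f). Qed.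

Definition induct_unit_map (X : RModule R) : Hom X (T X) := q X ∘ tens_unit S X.

Lemma induct_unit_act (X : RModule R) :
  act X ∘ (induct_unit_map X ⊠ idm S) = q X.
Proof.
unfold induct_unit_map; simpl.
rewrite tensm_l, compA, induct_proj_act, <- compA.
rewrite free_act_tens_unit; apply compm1.
Qed.

(** Both sides equal [q X ∘ (idm X ⊠ phi)]: on the left, balancing moves the action of [R] across to
    [S], where acting on the unit of [S] gives [phi]. *)
Lemma induct_unit_linear (X : RModule R) :
  induct_unit_map X ∘ ract X
  = act X ∘ (idm (T X) ⊠ phi) ∘ (induct_unit_map X ⊠ idm R).
Proof.
rewrite <- compA, tensm_swap, compA, induct_unit_act.
unfold induct_unit_map.
rewrite <- compA, <- tens_unit_nat, compA, induct_proj_balanced, <- !compA.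
rewrite assoc_tens_unit, <- tensm_r, <- compA, tens_unit_nat, compA.
now rewrite amul_tens_unit, comp1m.
Qed.

Definition induct_unit (X : RModule R) : RModuleHom X (Res (Ind X)) :=
  Build_RModuleHom (N := Res (Ind X)) (induct_unit_linear X).

(** The counit is the action of [S] on [N]; associativity of that action makes it balanced over
    [R]. *)
Lemma induct_counit_subproof (N : RModule S) :
  ract N ∘ (ract (Res N) ⊠ idm S) = ract N ∘ ((idm N ⊠ mu) ∘ assoc N R S).
Proof.
simpl.
rewrite tensm_l, compA, ractA, tensm_r, <- !compA.
now rewrite assoc_nat.
Qed.

Definition induct_counit_map (N : RModule S) : Hom (T (Res N)) N :=
  coeq_desc (induct_projP (Res N)) (induct_counit_subproof N).

Lemma induct_counitE (N : RModule S) : induct_counit_map N ∘ q (Res N) = ract N.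
Proof. apply coeq_descE. Qed.

Lemma induct_counit_linear (N : RModule S) :
  induct_counit_map N ∘ act (Res N) = ract N ∘ (induct_counit_map N ⊠ idm S).
Proof.
apply induct_proj_tens.
rewrite <- !compA, <- tensm_l, induct_counitE, induct_proj_act.
rewrite compA, induct_counitE; unfold free_act; rewrite compA.
exact (eq_sym (ractA N)).
Qed.

Definition induct_counit (N : RModule S) : RModuleHom (Ind (Res N)) N :=
  Build_RModuleHom (M := Ind (Res N)) (induct_counit_linear N).

Lemma induct_unit_nat (X Y : RModule R) (f : RModuleHom X Y) :
  induct_unit_map Y ∘ f = induct_mor K phi f ∘ induct_unit_map X.
Proof.
unfold induct_unit_map.
now rewrite compA, induct_proj_mor, <- !compA, tens_unit_nat.
Qed.

Lemma induct_counit_nat (M N : RModule S) (f : RModuleHom M N) :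
  induct_counit_map N ∘ induct_mor K phi (restrict_hom phi f) = f ∘ induct_counit_map M.
Proof.
apply (coeq_epi (induct_projP (Res M))).
rewrite <- !compA, induct_proj_mor, induct_counitE, compA, induct_counitE.
exact (eq_sym (rhomP f)).
Qed.

Lemma induct_triangle_l (X : RModule R) :
  induct_counit_map (Ind X) ∘ induct_mor K phi (induct_unit X) = idm (T X).
Proof.
apply (coeq_epi (induct_projP X)).
rewrite <- compA, induct_proj_mor, compA, induct_counitE, comp1m.
apply induct_unit_act.
Qed.

Lemma induct_triangle_r (N : RModule S) :
  induct_counit_map N ∘ induct_unit_map (Res N) = idm N.
Proof.
unfold induct_unit_map; rewrite compA, induct_counitE; exact (ract_tens_unit N).
Qed.

(* A natural retraction [γ_X : X ⊗_R S -> X], given by its composite with the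
   projection from [X ⊗ S]: in this form it involves no coequalizer. *)
Record Retraction := {
  rtr :> forall X : RModule R, Hom (X ⊗ S) X;
  rtr_balanced : forall X : RModule R,
    rtr X ∘ (ract X ⊠ idm S)
    = rtr X ∘ ((idm X ⊠ (amul S ∘ (phi ⊠ idm S))) ∘ assoc X R S);
  rtr_linear : forall X : RModule R,
    ract X ∘ (rtr X ⊠ idm R) = rtr X ∘ (free_act S X ∘ (idm (X ⊗ S) ⊠ phi));
  rtr_nat : forall (X Y : RModule R) (f : RModuleHom X Y),
    f ∘ rtr X = rtr Y ∘ (f ⊠ idm S)
}.

Section ToRetraction.
Context (gamma : forall X : RMod R, Hom (Res (Ind X) : RMod R) X).
Context (Hgamma : @natural_retract (RMod R) (RMod S)
  (induction K all_coflat phi) (restriction phi) gamma).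

Lemma retraction_of_subproof (X : RModule R) :
  ract X ∘ ((rhom (gamma X) ∘ q X) ⊠ idm R)
  = rhom (gamma X) ∘ q X ∘ (free_act S X ∘ (idm (X ⊗ S) ⊠ phi)).
Proof.
rewrite tensm_l, compA, <- rhomP; simpl.
rewrite <- !compA, tensm_swap, (compA (induct_act _ _ _ _)), induct_proj_act.
now rewrite <- !compA.
Qed.

Lemma retraction_of_nat (X Y : RModule R) (f : RModuleHom X Y) :
  f ∘ (rhom (gamma X) ∘ q X) = rhom (gamma Y) ∘ q Y ∘ (f ⊠ idm S).
Proof.
generalize (f_equal (fun g => rhom g) (Hgamma f)); simpl; intros e.
now rewrite compA, e, <- !compA, induct_proj_mor.
Qed.

Definition retraction_of : Retraction.
Proof.
exists (fun X => rhom (gamma X) ∘ q X).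
- intros X; now rewrite <- !compA, <- induct_proj_balanced.
- exact retraction_of_subproof.
- exact retraction_of_nat.
Defined.
End ToRetraction.

Section OfRetraction.
Context (c : Retraction).

Definition retract_map (X : RModule R) : Hom (T X) X :=
  coeq_desc (induct_projP X) (rtr_balanced c X).

Lemma retract_mapE (X : RModule R) : retract_map X ∘ q X = c X.
Proof. apply coeq_descE. Qed.

Lemma retract_map_linear (X : RModule R) :
  retract_map X ∘ (act X ∘ (idm (T X) ⊠ phi)) = ract X ∘ (retract_map X ⊠ idm R).
Proof.
apply induct_proj_tens.
rewrite <- !compA, <- tensm_l, retract_mapE, rtr_linear, tensm_swap.
rewrite (compA (induct_act _ _ _ _)), induct_proj_act, <- !compA.
now rewrite (compA (retract_map X)), retract_mapE.
Qed.

Definition retract_hom (X : RModule R) : RModuleHom (Res (Ind X)) X :=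
  Build_RModuleHom (M := Res (Ind X)) (retract_map_linear X).

Lemma retract_map_nat (X Y : RModule R) (f : RModuleHom X Y) :
  f ∘ retract_map X = retract_map Y ∘ induct_mor K phi f.
Proof.
apply (coeq_epi (induct_projP X)).
now rewrite <- !compA, retract_mapE, induct_proj_mor, compA, retract_mapE, rtr_nat.
Qed.
End OfRetraction.

Local Notation L := (induction K all_coflat phi).
Local Notation U := (restriction phi).

Definition unit_hom (X : RMod R) : Hom X (U (L X)) := induct_unit X.
Definition counit_hom (N : RMod S) : Hom (L (U N)) N := induct_counit N.

Lemma unit_hom_nat (X Y : RMod R) (f : Hom X Y) :
  unit_hom Y ∘ f = fmap U (fmap L f) ∘ unit_hom X.
Proof. apply RModuleHom_eq, induct_unit_nat. Qed.

Lemma counit_hom_nat (M N : RMod S) (f : Hom M N) :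
  counit_hom N ∘ fmap L (fmap U f) = f ∘ counit_hom M.
Proof. apply RModuleHom_eq, induct_counit_nat. Qed.

Lemma unit_counit_l (X : RMod R) :
  counit_hom (L X) ∘ fmap L (unit_hom X) = idm (L X).
Proof. apply RModuleHom_eq, induct_triangle_l. Qed.

Lemma unit_counit_r (N : RMod S) :
  fmap U (counit_hom N) ∘ unit_hom (U N) = idm (U N).
Proof. apply RModuleHom_eq, induct_triangle_r. Qed.

Lemma retract_hom_natural (c : Retraction) :
  @natural_retract (RMod R) (RMod S) L U (retract_hom c).
Proof. intros X Y f; apply RModuleHom_eq, (retract_map_nat c). Qed.

Lemma separable_iff_retraction :
  separable L <->
  exists c : Retraction, forall X : RModule R, c X ∘ tens_unit S X = idm X.
Proof.
rewrite (separable_iff_retract unit_hom_nat counit_hom_nat unit_counit_l).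
split.
- intros [gamma [Hg gK]]; exists (retraction_of Hg); intros X; simpl.
  rewrite <- compA; exact (f_equal (fun g => rhom g) (gK X)).
- intros [c cK]; exists (retract_hom c); split.
  + apply retract_hom_natural.
  + intros X; apply RModuleHom_eq; simpl; unfold induct_unit_map.
    rewrite compA, retract_mapE; apply cK.
Qed.

(** The condition is [η γ = 1] precomposed with the projection [q X], which can be cancelled because
    it is a coequalizer. *)
Lemma naturally_full_iff_retraction :
  naturally_full L <->
  exists c : Retraction, forall X : RModule R, induct_unit_map X ∘ c X = q X.
Proof.
rewrite (naturally_full_iff_retract unit_hom_nat counit_hom_nat unit_counit_l
  unit_counit_r).
split.
- intros [gamma [Hg gK]]; exists (retraction_of Hg); intros X; simpl.
  rewrite compA; refine (eq_trans _ (comp1m (q X))); f_equal.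
  exact (f_equal (fun g => rhom g) (gK X)).
- intros [c cK]; exists (retract_hom c); split.
  + apply retract_hom_natural.
  + intros X; apply RModuleHom_eq, (coeq_epi (induct_projP X)); simpl.
    rewrite <- compA, retract_mapE, cK, comp1m; reflexivity.
Qed.

Lemma semiseparable_iff_retraction :
  semiseparable L <->
  exists c : Retraction, forall X : RModule R,
    induct_unit_map X ∘ c X ∘ tens_unit S X = induct_unit_map X.
Proof.
rewrite (semiseparable_iff_retract unit_hom_nat counit_hom_nat unit_counit_l).
split.
- intros [gamma [Hg gK]]; exists (retraction_of Hg); intros X; simpl.
  rewrite compA, <- compA; exact (f_equal (fun g => rhom g) (gK X)).
- intros [c cK]; exists (retract_hom c); split.
  + apply retract_hom_natural.
  + intros X; apply RModuleHom_eq; simpl.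
    (* Only the right-hand side is expanded; then [γ q = c] identifies the two sides. *)
    rewrite <- (cK X) at 3; unfold induct_unit_map.
    now rewrite <- !compA, (compA (retract_map c X)), retract_mapE.
Qed.
End InductionRestriction.

(** * Images of modules under a strong monoidal functor *)

Section MapModule.
Context (C D : MonoidalCategory) (F : StrongMonoidalFunctor C D).

Lemma phi2_natl (X X' Y : C) (f : Hom X X') :
  phi2 F X' Y ∘ (fmap F f ⊠ idm (F Y)) = fmap F (f ⊠ idm Y) ∘ phi2 F X Y.
Proof. now rewrite <- fmap1, phi2_nat. Qed.

Lemma phi2_natr (X Y Y' : C) (g : Hom Y Y') :
  phi2 F X Y' ∘ (idm (F X) ⊠ fmap F g) = fmap F (idm X ⊠ g) ∘ phi2 F X Y.
Proof. now rewrite <- fmap1, phi2_nat. Qed.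

(** Coherence of [phi2] with the associator, for an arbitrary [g], so that it serves both the
    multiplication of an algebra and the left action of [R] on [S]. *)
Lemma phi2_act (X Y Z V : C) (g : Hom (Y ⊗ Z) V) :
  fmap F ((idm X ⊠ g) ∘ assoc X Y Z) ∘ (phi2 F (X ⊗ Y) Z ∘ (phi2 F X Y ⊠ idm (F Z)))
  = phi2 F X V ∘ ((idm (F X) ⊠ (fmap F g ∘ phi2 F Y Z)) ∘ assoc (F X) (F Y) (F Z)).
Proof.
rewrite fmapM, <- compA, (compA (fmap F (assoc X Y Z))), phi2A.
now rewrite tensm_r, !compA, phi2_natr.
Qed.

Context (A : Algebra C).
Local Notation FA := (map_algebra F A).

Lemma map_tens_unit (X : C) :
  phi2 F X A ∘ tens_unit FA (F X) = fmap F (tens_unit A X).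
Proof.
apply (iso_epi (runit_iso (F X))).
rewrite <- compA; refine (eq_trans (f_equal _ (tens_unit_runit FA (F X))) _); simpl.
rewrite <- phi2_1r, tensm_r, !compA, phi2_natr, <- fmapM.
now rewrite tens_unit_runit.
Qed.

Lemma map_free_act (X : C) :
  phi2 F X A ∘ free_act FA (F X)
  = fmap F (free_act A X) ∘ (phi2 F (X ⊗ A) A ∘ (phi2 F X A ⊠ idm (F A))).
Proof. exact (eq_sym (phi2_act X (amul A))). Qed.

Lemma map_actA (M : RModule A) (nu := fmap F (ract M) ∘ phi2 F M A) :
  nu ∘ (nu ⊠ idm FA) = nu ∘ (idm (F M) ⊠ amul FA) ∘ assoc (F M) FA FA.
Proof.
unfold nu; simpl.
rewrite <- !compA, <- phi2_act, tensm_l, (compA (phi2 F M A)), phi2_natl.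
rewrite <- !compA, !(compA (fmap F (ract M))), <- !fmapM.
now rewrite ractA, (compA (ract M)).
Qed.

Lemma map_act1 (M : RModule A) :
  fmap F (ract M) ∘ phi2 F M A ∘ (idm (F M) ⊠ aunit FA) = runit (F M).
Proof.
simpl.
rewrite tensm_r, <- compA, (compA (phi2 F M A)), phi2_natr, !compA, <- fmapM.
now rewrite ract1, phi2_1r.
Qed.

Definition map_module (M : RModule A) : RModule FA :=
  {| rmod := F M; ract := fmap F (ract M) ∘ phi2 F M A : Hom (F M ⊗ FA) (F M);
     ractA := map_actA M; ract1 := map_act1 M |}.

Local Notation FL Y := (map_module (free_module A Y)).

Lemma map_free_act_unit (Y : C) :
  fmap F (free_act A Y) ∘ phi2 F (Y ⊗ A) A ∘ (fmap F (tens_unit A Y) ⊠ idm (F A))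
  = phi2 F Y A.
Proof.
rewrite <- compA, phi2_natl, compA, <- fmapM, free_act_tens_unit, fmap1.
apply comp1m.
Qed.

Section MapExtension.
Context (Y : C) (M : RModule FA).

(** Through the isomorphism [phi2], the module [F (Y ⊗ A)] is free over [F A] on [F Y], with
    generators included by [fmap F (tens_unit A Y)]; a linear map is determined on generators. *)
Lemma map_ext_unique (f g : RModuleHom (FL Y) M) :
  rhom f ∘ fmap F (tens_unit A Y) = rhom g ∘ fmap F (tens_unit A Y) ->
  rhom f = rhom g.
Proof.
assert (T : forall k : RModuleHom (FL Y) M,
  rhom k ∘ phi2 F Y A
  = ract M ∘ ((rhom k ∘ fmap F (tens_unit A Y)) ⊠ idm (F A))).
{ intros k; rewrite tensm_l, compA, <- (map_free_act_unit Y), compA.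
  f_equal; exact (rhomP k). }
intros e; apply (iso_epi (phi2_iso F Y A)).
exact (eq_trans (T f) (eq_trans (f_equal (fun u => ract M ∘ (u ⊠ idm (F A))) e)
  (eq_sym (T g)))).
Qed.

Context (h : Hom (F Y) M).

(** The free extension of [h] in [D], transported from [F Y ⊗ F A] to [F (Y ⊗ A)]. *)
Definition map_ext_map : Hom (F (Y ⊗ A)) M :=
  ract M ∘ (h ⊠ idm FA) ∘ iso_inv (phi2_iso F Y A).

Lemma map_ext_phi2 : map_ext_map ∘ phi2 F Y A = ract M ∘ (h ⊠ idm FA).
Proof. unfold map_ext_map; rewrite <- compA, iso_invK; apply compm1. Qed.

Lemma map_ext_linear :
  map_ext_map ∘ (fmap F (free_act A Y) ∘ phi2 F (Y ⊗ A) A)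
  = ract M ∘ (map_ext_map ⊠ idm FA).
Proof.
apply (iso_epi (a := phi2 F Y A ⊠ idm (F A))).
- exists (iso_inv (phi2_iso F Y A) ⊠ idm (F A)).
  now rewrite <- !tensm_l, iso_invK, iso_Kinv, !tensm1.
- rewrite <- !compA, <- map_free_act, compA, map_ext_phi2, free_ext_linear.
  f_equal; rewrite <- map_ext_phi2; apply tensm_l.
Qed.

Definition map_ext : RModuleHom (FL Y) M :=
  Build_RModuleHom (M := FL Y) map_ext_linear.

Lemma map_extE : map_ext_map ∘ fmap F (tens_unit A Y) = h.
Proof.
rewrite <- map_tens_unit, compA, map_ext_phi2.
exact (free_extE h).
Qed.
End MapExtension.

Definition map_hom (M N : RModule A) (f : RModuleHom M N) :
  RModuleHom (map_module M) (map_module N).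
Proof.
exists (fmap F f); simpl.
now rewrite <- compA, phi2_natl, !compA, <- !fmapM, rhomP.
Defined.

(** Fullness lifts the restriction of [f] to generators to a map [Y -> N] in [C]. The image of its
    free extension agrees with [f] on generators, hence everywhere. *)
Lemma map_hom_full (F_full : full F) (Y : C) (N : RModule A)
    (f : RModuleHom (FL Y) (map_module N)) :
  exists g : RModuleHom (free_module A Y) N, rhom f = fmap F g.
Proof.
destruct (F_full _ _ (rhom f ∘ fmap F (tens_unit A Y))) as [h Hh].
exists (free_ext h).
apply (map_ext_unique (g := map_hom (free_ext h))).
rewrite <- Hh; simpl; rewrite <- fmapM; f_equal; exact (eq_sym (free_extE h)).
Qed.
End MapModule.

(** * Transfer of a retraction along [F] *)

Section Transfer.
Context (C D : MonoidalCategory) (KC : Coequalizers C) (KD : Coequalizers D).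
Context (R S : Algebra C) (phi : AlgebraHom R S).
Context (F : StrongMonoidalFunctor C D).

Local Notation FR := (map_algebra F R).
Local Notation FS := (map_algebra F S).
Local Notation Fphi := (map_algebra_hom F phi).
Local Notation FM M := (map_module F M).
Local Notation mu := (amul S ∘ (phi ⊠ idm S)).
Local Notation mu' := (amul FS ∘ (Fphi ⊠ idm FS)).

(** With [map_balance_r], this identifies, up to the isomorphisms [phi2], the image under [F] of the
    pair defining [M ⊗_R S] with the pair defining [F M ⊗_{F R} F S]. *)
Lemma map_balance_l (M : RModule R) :
  fmap F (ract M ⊠ idm S) ∘ (phi2 F (M ⊗ R) S ∘ (phi2 F M R ⊠ idm (F S)))
  = phi2 F M S ∘ (ract (FM M) ⊠ idm FS).
Proof.
simpl; now rewrite tensm_l, !compA, phi2_natl.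
Qed.

Lemma map_balance_r (M : RModule R) :
  fmap F ((idm M ⊠ mu) ∘ assoc M R S)
    ∘ (phi2 F (M ⊗ R) S ∘ (phi2 F M R ⊠ idm (F S)))
  = phi2 F M S ∘ ((idm (FM M) ⊠ mu') ∘ assoc (FM M) FR FS).
Proof.
rewrite phi2_act; simpl.
now rewrite <- (compA (fmap F (amul S))), phi2_natl,
  (compA (fmap F (amul S))), <- fmapM.
Qed.

Lemma phi2_phi2_iso (X Y Z : C) :
  is_iso (phi2 F (X ⊗ Y) Z ∘ (phi2 F X Y ⊠ idm (F Z))).
Proof.
exists ((iso_inv (phi2_iso F X Y) ⊠ idm (F Z)) ∘ iso_inv (phi2_iso F (X ⊗ Y) Z)).
split.
- rewrite <- compA, (compA (iso_inv _)), iso_invK, comp1m, <- tensm_l, iso_invK.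
  apply tensm1.
- rewrite <- compA, (compA (_ ⊠ _)), <- tensm_l, iso_Kinv, tensm1, comp1m.
  apply iso_Kinv.
Qed.

(** The image under [F] of the projection is again a coequalizer, and the projection in [D], read
    through [phi2], coequalizes the same pair. The comparison map [j] carries identities between
    maps into [M ⊗_R S] over to [D]. *)
Lemma map_proj_factor (F_coeq : preserves_coequalizers F) (M : RModule R) :
  exists j, induct_proj KD Fphi (FM M)
    = j ∘ fmap F (induct_proj KC phi M) ∘ phi2 F M S.
Proof.
set (h := induct_proj KD Fphi (FM M) ∘ iso_inv (phi2_iso F M S)).
assert (hE : h ∘ phi2 F M S = induct_proj KD Fphi (FM M)).
{ unfold h; rewrite <- compA, iso_invK; apply compm1. }
assert (e : h ∘ fmap F (ract M ⊠ idm S) = h ∘ fmap F ((idm M ⊠ mu) ∘ assoc M R S)).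
{ apply (iso_epi (phi2_phi2_iso M R S)).
  rewrite <- !compA, map_balance_l, map_balance_r.
  refine (eq_trans (compA _ _ _) _); refine (eq_trans _ (eq_sym (compA _ _ _))).
  rewrite hE; exact (induct_proj_balanced KD Fphi (FM M)). }
destruct (coeq_desc_ex (F_coeq _ _ _ _ _ _ (induct_projP KC phi M)) e) as [j Hj].
exists j; now rewrite Hj, hE.
Qed.

Context (F_full : full F) (F_esssurj : essentially_surjective F).
Context (c : Retraction phi).

Definition map_rtr (M : RModule R) : Hom (F M ⊗ F S) (F M) :=
  fmap F (c M) ∘ phi2 F M S.

Lemma map_rtr_balanced (M : RModule R) :
  map_rtr M ∘ (ract (FM M) ⊠ idm FS)
  = map_rtr M ∘ ((idm (FM M) ⊠ mu') ∘ assoc (FM M) FR FS).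
Proof.
unfold map_rtr; refine (eq_trans (eq_sym (compA _ _ _)) _).
refine (eq_trans _ (compA _ _ _)); rewrite <- map_balance_l, <- map_balance_r.
now rewrite !(compA (fmap F (c M))), <- !fmapM, rtr_balanced.
Qed.

Lemma map_rtr_linear (M : RModule R) :
  ract (FM M) ∘ (map_rtr M ⊠ idm FR)
  = map_rtr M ∘ (free_act FS (F M) ∘ (idm (F M ⊗ F S) ⊠ fmap F phi)).
Proof.
unfold map_rtr; refine (eq_trans _ (compA _ _ _)).
rewrite (compA (phi2 F M S)), map_free_act, <- !compA, <- tensm_swap.
rewrite (compA (phi2 F (M ⊗ S) S)), phi2_natr; simpl.
rewrite tensm_l, <- !compA, (compA (phi2 F M R)), phi2_natl, <- !compA.
rewrite !(compA (fmap F _) (fmap F _)), <- !fmapM, rtr_linear.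
now rewrite (compA (c M)), fmapM, <- compA.
Qed.

Lemma map_rtr_fmap (M N : RModule R) (g : RModuleHom M N) :
  fmap F g ∘ map_rtr M = map_rtr N ∘ (fmap F g ⊠ idm (F S)).
Proof.
unfold map_rtr; now rewrite <- compA, phi2_natl, !compA, <- !fmapM, rtr_nat.
Qed.

Definition free_rtr (Y : C) : Hom (F (Y ⊗ R) ⊗ F S) (F (Y ⊗ R)) :=
  map_rtr (free_module R Y).

(** Between images of free modules every linear map is the image of a linear map in [C], where [c]
    is natural. The separate [k] lets its type be spelled with [F (Y ⊗ R)], which suits
    rewriting. *)
Lemma free_rtr_nat (Y Y' : C) (k : Hom (F (Y ⊗ R)) (F (Y' ⊗ R)))
    (f : RModuleHom (FM (free_module R Y)) (FM (free_module R Y'))) :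
  rhom f = k -> k ∘ free_rtr Y = free_rtr Y' ∘ (k ⊠ idm (F S)).
Proof.
intros <-; destruct (map_hom_full F_full f) as [g ->]; exact (map_rtr_fmap g).
Qed.

Section RetractionAlong.
Context (M : RModule FR).

(* The value of the retraction on [M], composed with [h ⊠ idm]; it is forced by
   naturality along the linear extension [F (Y ⊗ R) -> M] of [h]. *)
Definition rtr_along (Y : C) (h : Hom (F Y) M) : Hom (F Y ⊗ F S) M :=
  map_ext_map h ∘ free_rtr Y ∘ (fmap F (tens_unit R Y) ⊠ idm (F S)).

(** The linear extension [k'] of [k] to [F (Y ⊗ R) -> F (Y' ⊗ R)] commutes with [free_rtr], and
    extending [h ∘ k] amounts to composing the extension of [h] with [k'], since both agree on
    generators. *)
Lemma rtr_along_pre (Y Y' : C) (h : Hom (F Y') M) (k : Hom (F Y) (F Y')) :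
  rtr_along (h ∘ k) = rtr_along h ∘ (k ⊠ idm (F S)).
Proof.
assert (E : exists k' : Hom (F (Y ⊗ R)) (F (Y' ⊗ R)),
  k' ∘ free_rtr Y = free_rtr Y' ∘ (k' ⊠ idm (F S)) /\
  k' ∘ fmap F (tens_unit R Y) = fmap F (tens_unit R Y') ∘ k /\
  map_ext_map (h ∘ k) = map_ext_map h ∘ k').
{ set (k' := map_ext (M := FM (free_module R Y')) (fmap F (tens_unit R Y') ∘ k)).
  assert (k'E := map_extE (M := FM (free_module R Y'))
    (fmap F (tens_unit R Y') ∘ k)).
  exists (rhom k'); repeat split.
  - now apply (free_rtr_nat (f := k')).
  - exact k'E.
  - apply (map_ext_unique (f := map_ext (h ∘ k)) (g := rhom_comp (map_ext h) k')).
    refine (eq_trans (map_extE (h ∘ k)) _).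
    refine (eq_trans _ (compA _ _ _)).
    refine (eq_trans _ (eq_sym (f_equal _ k'E))).
    refine (eq_trans _ (eq_sym (compA _ _ _))).
    exact (eq_sym (f_equal (fun u => u ∘ k) (map_extE h))). }
destruct E as [k' [nat [k'E e]]]; unfold rtr_along.
rewrite e, <- (compA (map_ext_map h)), nat, <- !compA; do 2 f_equal.
now rewrite <- !tensm_l, k'E.
Qed.
End RetractionAlong.

Lemma rtr_along_post (M N : RModule FR) (f : RModuleHom M N) (Y : C)
    (h : Hom (F Y) M) :
  rtr_along (f ∘ h) = f ∘ rtr_along h.
Proof.
unfold rtr_along; rewrite !compA; do 2 f_equal.
apply (map_ext_unique (f := map_ext (f ∘ h)) (g := rhom_comp f (map_ext h))).
refine (eq_trans (map_extE (f ∘ h)) _); simpl.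
now rewrite <- compA, map_extE.
Qed.

(** The extension [i] of the identity commutes with [free_rtr] and is the identity on generators, so
    it cancels. Hence the transferred retraction on images of free modules is the image of [c]. *)
Lemma rtr_along_id (Y : C) :
  rtr_along (M := FM (free_module R Y)) (idm (F (Y ⊗ R)))
  = free_rtr Y.
Proof.
set (i := map_ext (M := FM (free_module R Y)) (idm (F (Y ⊗ R)))).
unfold rtr_along.
rewrite (free_rtr_nat (f := i) (k := map_ext_map (M := FM (free_module R Y)) _));
  [ | reflexivity].
rewrite <- compA, <- tensm_l.
refine (eq_trans (f_equal (fun u => _ ∘ (u ⊠ _))
  (map_extE (M := FM (free_module R Y)) (idm (F (Y ⊗ R))))) _).
rewrite tensm1; apply compm1.
Qed.

Definition cover (M : D) : C :=
  proj1_sig (constructive_indefinite_description _ (F_esssurj M)).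

Definition cover_map (M : D) : Hom (F (cover M)) M :=
  proj1_sig (constructive_indefinite_description _
    (proj2_sig (constructive_indefinite_description _ (F_esssurj M)))).

Lemma cover_map_iso (M : D) : is_iso (cover_map M).
Proof.
exact (proj2_sig (constructive_indefinite_description _
    (proj2_sig (constructive_indefinite_description _ (F_esssurj M))))).
Qed.

(** Conjugation by the chosen isomorphism from an object in the image of [F]; [transfer_rtr_along]
    shows that the choice does not matter. *)
Definition transfer_rtr (M : RModule FR) : Hom (M ⊗ FS) M :=
  rtr_along (cover_map M) ∘ (iso_inv (cover_map_iso M) ⊠ idm (F S)).

Lemma transfer_rtr_along (M : RModule FR) (Y : C) (h : Hom (F Y) M) :
  transfer_rtr M ∘ (h ⊠ idm FS) = rtr_along h.
Proof.
unfold transfer_rtr; rewrite <- compA; simpl.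
rewrite <- tensm_l, <- rtr_along_pre, compA, iso_Kinv; now rewrite comp1m.
Qed.

(** Composing the cover of [M] with [f] gives another map into [N] from the image of [F], to which
    [transfer_rtr_along] applies. *)
Lemma transfer_rtr_nat (M N : RModule FR) (f : RModuleHom M N) :
  f ∘ transfer_rtr M = transfer_rtr N ∘ (f ⊠ idm FS).
Proof.
unfold transfer_rtr at 1.
rewrite compA, <- rtr_along_post, <- transfer_rtr_along, <- compA.
f_equal; simpl; rewrite <- tensm_l, <- compA, iso_Kinv; now rewrite compm1.
Qed.

Section Presentation.
Context (M : RModule FR).
Local Notation X := (cover M).

Definition presentation : RModuleHom (FM (free_module R X)) M :=
  map_ext (cover_map M).

(** The section is a map of [D], with no linearity claimed. Split epimorphisms survive tensoring, so
    identities of maps out of [M], [M ⊗ Y] and [(M ⊗ Y) ⊗ Y'] may be tested on the presentation. *)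
Lemma presentation_split : exists s : Hom M (F (X ⊗ R)), rhom presentation ∘ s = idm M.
Proof.
exists (fmap F (tens_unit R X) ∘ iso_inv (cover_map_iso M)).
rewrite compA; refine (eq_trans (f_equal (fun u => u ∘ _) (map_extE (cover_map M))) _).
apply iso_Kinv.
Qed.

Lemma transfer_rtr_presentation :
  transfer_rtr M ∘ (presentation ⊠ idm FS)
  = presentation ∘ free_rtr X.
Proof.
rewrite <- transfer_rtr_nat; f_equal.
rewrite <- rtr_along_id, <- transfer_rtr_along; simpl.
rewrite tensm1; symmetry; apply compm1.
Qed.

Lemma presentation_epi (Z : D) (k k' : Hom M Z) :
  k ∘ presentation = k' ∘ presentation -> k = k'.
Proof.
destruct presentation_split as [s ps]; intros e.
now rewrite <- (compm1 k), <- ps, compA, e, <- compA, ps, compm1.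
Qed.

Lemma presentation_tens_epi (Y Z : D) (k k' : Hom (M ⊗ Y) Z) :
  k ∘ (presentation ⊠ idm Y) = k' ∘ (presentation ⊠ idm Y) -> k = k'.
Proof.
destruct presentation_split as [s ps]; intros e.
rewrite <- (compm1 k), <- tensm1, <- ps, tensm_l, compA, e.
now rewrite <- compA, <- tensm_l, ps, tensm1, compm1.
Qed.

Lemma presentation_tens2_epi (Y Y' Z : D) (k k' : Hom ((M ⊗ Y) ⊗ Y') Z) :
  k ∘ ((presentation ⊠ idm Y) ⊠ idm Y') = k' ∘ ((presentation ⊠ idm Y) ⊠ idm Y') ->
  k = k'.
Proof.
destruct presentation_split as [s ps]; intros e.
rewrite <- (compm1 k), <- !tensm1, <- ps, !tensm_l, compA, e.
now rewrite <- compA, <- !tensm_l, ps, !tensm1, compm1.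
Qed.

(** After precomposition with the presentation, naturality reduces this to the free module, where it
    is the image of balancedness in [C]. Linearity below follows the same pattern. *)
Lemma transfer_rtr_balanced :
  transfer_rtr M ∘ (ract M ⊠ idm FS)
  = transfer_rtr M ∘ ((idm M ⊠ mu') ∘ assoc M FR FS).
Proof.
apply presentation_tens2_epi.
rewrite <- !compA, <- tensm_l, <- rhomP, tensm_l, compA.
rewrite transfer_rtr_presentation.
rewrite assoc_nat, tensm1, (compA (idm M ⊠ mu')), tensm_swap.
rewrite !compA, transfer_rtr_presentation, <- !compA; f_equal.
exact (map_rtr_balanced (free_module R X)).
Qed.

Lemma transfer_rtr_linear :
  ract M ∘ (transfer_rtr M ⊠ idm FR)
  = transfer_rtr M ∘ (free_act FS M ∘ (idm (M ⊗ FS) ⊠ Fphi)).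
Proof.
apply presentation_tens2_epi.
rewrite <- !compA, <- tensm_l, transfer_rtr_presentation, tensm_swap.
rewrite tensm_l, compA, <- rhomP.
unfold free_act; rewrite <- !compA, (compA (assoc M FS FS)), assoc_nat, tensm1.
rewrite <- !compA, (compA (idm M ⊠ amul FS)), tensm_swap, !compA.
rewrite transfer_rtr_presentation, <- !compA; f_equal.
rewrite (compA (idm _ ⊠ amul FS)).
exact (map_rtr_linear (free_module R X)).
Qed.
End Presentation.

Definition transfer : Retraction Fphi :=
  Build_Retraction transfer_rtr_balanced transfer_rtr_linear transfer_rtr_nat.

Lemma map_rtr_tens_unit (M : RModule R) :
  map_rtr M ∘ tens_unit FS (F M) = fmap F (c M ∘ tens_unit S M).
Proof.
unfold map_rtr; rewrite fmapM, <- map_tens_unit; exact (eq_sym (compA _ _ _)).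
Qed.

Lemma transfer_tens_unit (M : RModule FR) :
  transfer_rtr M ∘ tens_unit FS M ∘ presentation M
  = presentation M
    ∘ fmap F (c (free_module R (cover M)) ∘ tens_unit S (cover M ⊗ R)).
Proof.
rewrite <- compA, <- tens_unit_nat, compA, transfer_rtr_presentation.
rewrite <- compA; f_equal; exact (map_rtr_tens_unit (free_module R (cover M))).
Qed.

Lemma transfer_section :
  (forall X : RModule R, c X ∘ tens_unit S X = idm X) ->
  forall M : RModule FR, transfer M ∘ tens_unit FS M = idm M.
Proof.
intros cK M; apply presentation_epi.
change (transfer M) with (transfer_rtr M).
rewrite transfer_tens_unit, comp1m.
refine (eq_trans (f_equal (fun u => _ ∘ fmap F u) (cK (free_module R (cover M)))) _).
rewrite fmap1; apply compm1.
Qed.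

(** One and the same [j] compares both projections and units, so an identity relating them in [C]
    can be mapped by [F] and then composed with [j]. *)
Lemma induct_unit_map_factor (F_coeq : preserves_coequalizers F) (M : RModule R) :
  exists j,
    induct_proj KD Fphi (FM M) = j ∘ fmap F (induct_proj KC phi M) ∘ phi2 F M S /\
    induct_unit_map KD Fphi (FM M) = j ∘ fmap F (induct_unit_map KC phi M).
Proof.
destruct (map_proj_factor F_coeq M) as [j Hj]; exists j; split; [exact Hj|].
unfold induct_unit_map; rewrite fmapM, <- map_tens_unit.
refine (eq_trans (f_equal (fun u => u ∘ _) Hj) _).
now rewrite !compA.
Qed.

Lemma transfer_retract_id (F_coeq : preserves_coequalizers F) :
  (forall X : RModule R, induct_unit_map KC phi X ∘ c X = induct_proj KC phi X) ->
  forall M : RModule FR,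
  induct_unit_map KD Fphi M ∘ transfer M = induct_proj KD Fphi M.
Proof.
intros cK M; apply presentation_tens_epi.
change (transfer M) with (transfer_rtr M).
(* Naturality of the unit and of the projection moves the presentation to the left of both sides,
   leaving an identity on the image of a free module. *)
rewrite <- compA, transfer_rtr_presentation, compA, induct_unit_nat.
rewrite <- (induct_proj_mor KD Fphi (presentation M)), <- compA; f_equal.
destruct (induct_unit_map_factor F_coeq (free_module R (cover M))) as [j [qE eE]].
refine (eq_trans (f_equal (fun u => u ∘ _) eE) _).
refine (eq_trans _ (eq_sym qE)).
rewrite <- cK, fmapM, <- !compA; reflexivity.
Qed.

Lemma transfer_retract_unit (F_coeq : preserves_coequalizers F) :
  (forall X : RModule R,
    induct_unit_map KC phi X ∘ c X ∘ tens_unit S X = induct_unit_map KC phi X) ->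
  forall M : RModule FR,
  induct_unit_map KD Fphi M ∘ transfer M ∘ tens_unit FS M
  = induct_unit_map KD Fphi M.
Proof.
intros cK M; apply presentation_epi.
change (transfer M) with (transfer_rtr M).
rewrite <- (compA _ (transfer_rtr M)), <- compA, transfer_tens_unit, compA.
rewrite induct_unit_nat, <- compA; f_equal.
destruct (induct_unit_map_factor F_coeq (free_module R (cover M))) as [j [_ eE]].
refine (eq_trans (f_equal (fun u => u ∘ _) eE) (eq_trans _ (eq_sym eE))).
refine (eq_trans (eq_sym (compA _ _ _)) (f_equal _ _)).
refine (eq_trans (eq_sym (fmapM F _ _)) (f_equal _ _)).
exact (eq_trans (compA _ _ _) (cK (free_module R (cover M)))).
Qed.
End Transfer.

Theorem proposition3p28
  (C D : MonoidalCategory)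
  (KC : Coequalizers C) (KD : Coequalizers D)
  (coflatC : forall X : C, coflat X) (coflatD : forall X : D, coflat X)
  (R S : Algebra C) (phi : AlgebraHom R S)
  (F : StrongMonoidalFunctor C D)
  (F_full : full F)
  (F_esssurj : essentially_surjective F)
  (F_coeq : preserves_coequalizers F) :
  (semiseparable (induction KC coflatC phi) ->
   semiseparable (induction KD coflatD (map_algebra_hom F phi))) /\
  (separable (induction KC coflatC phi) ->
   separable (induction KD coflatD (map_algebra_hom F phi))) /\
  (naturally_full (induction KC coflatC phi) ->
   naturally_full (induction KD coflatD (map_algebra_hom F phi))).
Proof.
rewrite !semiseparable_iff_retraction, !separable_iff_retraction,
  !naturally_full_iff_retraction.
repeat split; intros [c cK]; exists (transfer F_full F_esssurj c).
- exact (transfer_retract_unit KD F_full F_esssurj F_coeq cK).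
- exact (transfer_section F_full F_esssurj cK).
- exact (transfer_retract_id KD F_full F_esssurj F_coeq cK).
Qed.
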